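(* For the path $P_n$ on $n$ vertices with the standard price function ($P\equiv 2$), and for every integer $t\ge 1$, the ratio $\pi^{t+1}(P_n)/\pi^{t}(P_n)$ does not depend on $n$ for $n\ge t+1$, and equals \[ \frac{2^{t+1}-1}{2(2^{t}-1)}. \]
   Context: A configuration of $k$ pebbles on a graph $G$ is a function $C:V(G)\to\mathbb{Z}_{\ge0}$ with total sum $k$. A pebbling move along an edge $uv$ removes two pebbles from $u$ and adds one pebble to $v$ (allowed only if $u$ has at least two pebbles). A configuration is $t$-solvable if for every set of $t$ vertices some sequence of pebbling moves yields a configuration with at least one pebble on each of those $t$ vertices. $\pi^t(G)$ is the minimum $k$ such that every configuration of $k$ pebbles on $G$ is $t$-solvable (defined for $1\le t\le |V(G)|$). In the paper this statement is phrased as: the pebbling ratio sequence $\alpha^t(\mathcal{P})=(\pi^{t+1}(P_n)/\pi^t(P_n))_n$ of the family of paths is constant. *)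

(* Defs.v *)
From HB Require Import structures.
From mathcomp Require Import all_boot all_order all_algebra.
From mathcomp Require Import boolp.

Set Implicit Arguments.
Unset Strict Implicit.
Unset Printing Implicit Defensive.

Import Order.TTheory GRing.Theory Num.Theory.

Record sgraph := SGraph {
  vertex :> finType;
  adj : rel vertex;
  adj_sym : symmetric adj;
  adj_irr : irreflexive adj }.

Section Pebbling.
Variable G : sgraph.

Definition config := {ffun G -> nat}.

Definition config_size (C : config) : nat := \sum_(x : G) C x.

(* The truncated subtraction is exact, since a move requires 2 <= C u. *)
Definition pebbling_move (C D : config) : Prop :=
  exists u v : G,
    [/\ adj u v, 2 <= C u
      & D = [ffun x => C x - (if x == u then 2 else 0)
                           + (if x == v then 1 else 0)]].

Inductive reachable (C : config) : config -> Prop :=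
| reach_refl : reachable C C
| reach_step D E : reachable C D -> pebbling_move D E -> reachable C E.

Definition solvable_config (t : nat) (C : config) : Prop :=
  forall S : {set G}, #|S| = t ->
    exists2 D : config, reachable C D & forall x : G, x \in S -> 0 < D x.

Definition all_solvable (t k : nat) : Prop :=
  forall C : config, config_size C = k -> solvable_config t C.

(* The least k such that [all_solvable t k]; the value 0 is a default, used
   only when no such k exists (as may happen if G is disconnected). *)
Definition pebbling_number (t : nat) : nat :=
  match pselect (exists k, `[< all_solvable t k >]) with
  | left ex_k => ex_minn ex_k
  | right _ => 0
  end.

Lemma pebbling_numberP (t k : nat) :
  all_solvable t k ->
  all_solvable t (pebbling_number t) /\
  forall j : nat, all_solvable t j -> pebbling_number t <= j.
Proof.
move=> Hk; rewrite /pebbling_number; case: pselect => [ex_k|[]]; last first.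
  by exists k; apply/asboolP.
by case: ex_minnP => m /asboolP Hm le_m; split=> // j /asboolP; apply: le_m.
Qed.

End Pebbling.

Definition path_adj (n : nat) : rel 'I_n :=
  fun i j => (i.+1 == j :> nat) || (j.+1 == i :> nat).

Lemma path_adj_sym (n : nat) : symmetric (@path_adj n).
Proof. by move=> i j; rewrite /path_adj orbC. Qed.

Lemma path_adj_irr (n : nat) : irreflexive (@path_adj n).
Proof. by move=> i; rewrite /path_adj orbb gtn_eqF. Qed.

Definition path_graph (n : nat) : sgraph :=
  SGraph (@path_adj_sym n) (@path_adj_irr n).

Definition pebbling_ratio (G : sgraph) (t : nat) : rat :=
  ((pebbling_number G t.+1)%:R / (pebbling_number G t)%:R)%R.

(* Main.v *)
Require Import Defs.
From mathcomp Require Import all_boot all_order all_algebra.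
From mathcomp Require Import zify.

(** The ratio follows from [pi^t(P_n) = 2^n - 2^(n-t)] for [t <= n].

    Lower bound: no move increases the weight [sum_x C(x) 2^x], so stacking
    all pebbles on vertex 0 and asking for the last [t] vertices requires
    [2^(n-t) + ... + 2^(n-1)] pebbles.

    Upper bound, by induction on [n], looking at the first vertex [u] and its
    [c] pebbles.  If [u] is not a target, push [c/2] pebbles to the next vertex;
    if it is a target and [c > 0], keep one pebble and push the others.  If it
    is a target and [c = 0], then [2^(n-1)] of the pebbles suffice to bring one
    pebble to [u], and the remaining [2^(n-1) - 2^(n-t)] pebbles, all off [u],
    cover the other [t-1] targets by induction. *)

(** * Adding and splitting configurations on an arbitrary graph *)

Section Configurations.
Set Implicit Arguments.
Unset Strict Implicit.

Context {G : sgraph}.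
Implicit Types (C D E : config G) (S : {set G}) (u v x : G).

Definition config_add C D : config G := [ffun x => C x + D x].
(** Truncated subtraction: it is exact when [D] lies below [C], and then gives the pebbles left
    after setting [D] aside. *)
Definition config_sub C D : config G := [ffun x => C x - D x].
Definition stack u (k : nat) : config G := [ffun x => if x == u then k else 0].

(** Solvability for one fixed target set, so that targets can be divided between separate parts of
    the pebbles. *)
Definition coverable C S : Prop :=
  exists2 D, reachable C D & forall x, x \in S -> 0 < D x.

Lemma reachable_trans C D E : reachable C D -> reachable D E -> reachable C E.
Proof. by move=> CD; elim=> // D' E' _ IH mv; exact: reach_step IH mv. Qed.

Lemma config_addC C D : config_add C D = config_add D C.
Proof. by apply/ffunP => x; rewrite !ffunE addnC. Qed.

Lemma config_subK C E :
  (forall x, E x <= C x) -> config_add E (config_sub C E) = C.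
Proof. by move=> le_EC; apply/ffunP => x; rewrite !ffunE subnKC. Qed.

(** Extra pebbles never block a move, so [E] stays in place while the moves from [C] to [D] are
    carried out. *)
Lemma reachable_addr C D E :
  reachable C D -> reachable (config_add C E) (config_add D E).
Proof.
elim=> [|D1 D2 _ IH [u [v [uv le2 ->]]]]; first exact: reach_refl.
apply: reach_step IH _; exists u, v; split=> //.
  by rewrite ffunE; lia.
apply/ffunP => x; rewrite !ffunE.
by case: (eqVneq x u) => [->|_]; case: ifP => _; lia.
Qed.

Lemma reachable_add C D C' D' : reachable C D -> reachable C' D' ->
  reachable (config_add C C') (config_add D D').
Proof.
move=> CD CD'; apply: reachable_trans (reachable_addr C' CD) _.
by rewrite ![config_add D _]config_addC; exact: reachable_addr.
Qed.

Lemma reachable_stack u v k : adj u v -> reachable (stack u k.*2) (stack v k).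
Proof.
move=> uv; elim: k => [|k IH].
  have -> : stack u 0.*2 = stack v 0.
    by apply/ffunP => x; rewrite !ffunE !if_same.
  exact: reach_refl.
have move1 : reachable (stack u 2) (stack v 1).
  apply: reach_step (reach_refl _) _; exists u, v; split=> //.
    by rewrite ffunE eqxx.
  by apply/ffunP => x; rewrite !ffunE subnn.
have stackD w i j : stack w (i + j) = config_add (stack w i) (stack w j).
  by apply/ffunP => x; rewrite !ffunE; case: ifP.
rewrite doubleS -addn2 -(addn1 k) (stackD u k.*2 2) (stackD v k 1).
exact: reachable_add.
Qed.

Lemma stack_le C u k : k <= C u -> forall x, stack u k x <= C x.
Proof. by move=> le_k x; rewrite ffunE; case: eqP => // ->. Qed.

Lemma reachable_push C u v k : adj u v -> k.*2 <= C u ->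
  reachable C (config_add (stack v k) (config_sub C (stack u k.*2))).
Proof.
move=> uv le_k; rewrite -{1}(config_subK (stack_le le_k)).
exact/reachable_addr/reachable_stack.
Qed.

Lemma reachable_coverable C D S :
  reachable C D -> coverable D S -> coverable C S.
Proof. by move=> CD [E DE ES]; exists E => //; exact: reachable_trans DE. Qed.

Lemma coverable_add C D S T : coverable C S -> coverable D T ->
  coverable (config_add C D) (S :|: T).
Proof.
move=> [C' CC' SC'] [D' DD' TD']; exists (config_add C' D').
  exact: reachable_add.
by move=> x; rewrite ffunE addn_gt0 => /setUP[/SC'|/TD'] ->; rewrite ?orbT.
Qed.

Lemma coverable0 C : coverable C set0.
Proof. by exists C => [|x]; [exact: reach_refl | rewrite inE]. Qed.

Lemma exists_subconfig (P : pred G) C k : k <= \sum_(x | P x) C x ->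
  exists2 E : config G, forall x, E x <= C x & \sum_(x | P x) E x = k.
Proof.
elim: k => [|k IH] le_k.
  by exists [ffun=> 0] => [x|]; rewrite ?ffunE // big1 // => x; rewrite ffunE.
have [E le_EC sumE] := IH (ltnW le_k).
(* If [E] reached [C] everywhere on [P], its sum [k] would be at least that of [C], which exceeds
   [k]. *)
have [u Pu lt_u] : exists2 u, P u & E u < C u.
  apply/exists_inP; apply: contraLR le_k => /exists_inPn leCE.
  rewrite -ltnNge ltnS -sumE; apply: leq_sum => x Px.
  by rewrite leqNgt leCE.
exists (config_add E (stack u 1)) => [x|].
  rewrite !ffunE; case: eqP => [->|_]; first by rewrite addn1.
  by rewrite addn0.
rewrite (eq_bigr (fun x => E x + stack u 1 x)) => [|x _]; last by rewrite ffunE.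
rewrite big_split sumE (bigD1 u Pu) /= ffunE eqxx big1 ?addn1 // => x.
by rewrite ffunE => /andP[_ /negPf->].
Qed.

End Configurations.

(** * Upper bound on paths *)

Section Path.
Set Implicit Arguments.
Unset Strict Implicit.

Variable n : nat.
Implicit Types (C D E : config (path_graph n)) (S : {set path_graph n}).

(** Inductions on the length of the path stay in one fixed graph: the vertices from [i] on stand for
    a shorter path. *)
Definition tail_size (i : nat) C : nat := \sum_(x : 'I_n | i <= x) C x.

Lemma tail_sizeS (u : 'I_n) C : tail_size u C = C u + tail_size u.+1 C.
Proof.
rewrite /tail_size (bigD1 u) //=; congr (_ + _); apply: eq_bigl => x.
by rewrite ltn_neqAle andbC eq_sym.
Qed.

Lemma tail_size_add i C D :
  tail_size i (config_add C D) = tail_size i C + tail_size i D.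
Proof. by rewrite -big_split; apply: eq_bigr => x _; rewrite ffunE. Qed.

Lemma tail_size_sub i C E : (forall x, E x <= C x) ->
  tail_size i (config_sub C E) = tail_size i C - tail_size i E.
Proof.
by move=> /config_subK {2}<-; rewrite tail_size_add addKn.
Qed.

Lemma tail_size_stack i (u : 'I_n) k :
  tail_size i (stack (G := path_graph n) u k) = (i <= u) * k.
Proof.
rewrite /tail_size; case: (leqP i u) => iu; last first.
  rewrite big1 // => x; rewrite ffunE; case: eqP => // ->.
  by rewrite leqNgt iu.
rewrite (bigD1 u) //= ffunE eqxx big1 ?addn0 ?mul1n // => x.
by rewrite ffunE => /andP[_ /negPf->].
Qed.

Lemma path_adjS (u v : 'I_n) : v = u.+1 :> nat -> adj (s := path_graph n) u v.
Proof. by move=> uv; rewrite /= /path_adj uv eqxx. Qed.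

Lemma card_tail i S : (forall x : 'I_n, x \in S -> i <= x) -> #|S| <= n - i.
Proof.
move=> leS; rewrite cardE -(size_map val) -(size_iota i (n - i)).
apply: uniq_leq_size.
  by rewrite map_inj_uniq ?enum_uniq //; exact: val_inj.
move=> _ /mapP[x xS ->]; rewrite mem_enum in xS; rewrite mem_iota leS //=.
by rewrite subnKC ?ltn_ord //; exact: leq_trans (leS x xS) (ltnW (ltn_ord x)).
Qed.

(** Here [m] is the distance from [u] to the last vertex. The pebbles already on [u] are kept, and
    twice the number still missing is requested from the next vertex by induction. *)
Lemma gather m (u : 'I_n) k C :
  u + m.+1 = n -> k * 2 ^ m <= tail_size u C ->
  exists2 D, reachable C D & k <= D u.
Proof.
elim: m u k C => [|m IH] u k C un; rewrite tail_sizeS.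
  rewrite muln1 [tail_size u.+1 C]big_pred0 => [le_k|x]; last first.
    by apply/negbTE; have := ltn_ord x; lia.
  by exists C; [exact: reach_refl | lia].
move=> le_k; case: (leqP k (C u)) => [leC|ltC].
  by exists C => //; exact: reach_refl.
have lt_v : u.+1 < n by lia.
pose v : 'I_n := Ordinal lt_v.
pose E := config_sub C (stack (G := path_graph n) u (C u)).
have leE := @stack_le _ C u (C u) (leqnn _).
have [||D ED leD] := IH v (k - C u).*2 E; first by rewrite /=; lia.
  rewrite tail_size_sub // tail_size_stack ltnn /= subn0.
  (* Each pebble on [u] lowers the requirement by [2 ^ m.+1] but the supply only by one. *)
  move: le_k; rewrite expnS -muln2; have : 0 < 2 ^ m by rewrite expn_gt0.
  by move: (2 ^ m) => p p0 /=; nia.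
exists (config_add (stack (G := path_graph n) u (C u))
  (config_add (stack (G := path_graph n) u (k - C u))
     (config_sub D (stack (G := path_graph n) v (k - C u).*2)))).
  rewrite -{1}(config_subK leE).
  apply: reachable_add; first exact: reach_refl.
  apply: reachable_trans ED _; apply: reachable_push => //.
  by rewrite adj_sym; exact: path_adjS.
by rewrite !ffunE eqxx; lia.
Qed.

Lemma coverable_push (u : 'I_n) C S :
  (forall x : 'I_n, x \in S -> u < x) ->
  (forall D, (C u)./2 + tail_size u.+1 C <= tail_size u.+1 D ->
    coverable D S) ->
  coverable C S.
Proof.
have [->|[x xS]] := set_0Vmem S; first by move=> _ _; exact: coverable0.
(* A target beyond [u] guarantees that the next vertex exists. *)
move=> leS covS; have lt_v : u.+1 < n := leq_ltn_trans (leS x xS) (ltn_ord x).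
have le_half : (C u)./2.*2 <= C u by lia.
have uv := @path_adjS u (Ordinal lt_v) erefl.
apply: reachable_coverable (reachable_push uv le_half) _.
apply: covS; rewrite tail_size_add tail_size_sub; last exact: stack_le.
by rewrite !tail_size_stack ltnn leqnn /= mul1n subn0.
Qed.

(** The tail has [m] vertices, and the bound [2 ^ m - 2 ^ (m - #|S|)] is stated additively to avoid
    truncated subtraction. *)
Lemma coverable_tail m i C S : i + m = n ->
  (forall x : 'I_n, x \in S -> i <= x) ->
  2 ^ m <= tail_size i C + 2 ^ (m - #|S|) -> coverable C S.
Proof.
elim: m i C S => [|m IH] i C S im leS.
  have /eqP S0 : #|S| == 0 by have := card_tail leS; lia.
  by rewrite (cards0_eq S0) => _; exact: coverable0.
have lt_i : i < n by lia.
pose u : 'I_n := Ordinal lt_i.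
have leS1 (x : 'I_n) : x \in S :\ u -> u < x.
  by rewrite !inE ltn_neqAle eq_sym => /andP[-> /leS].
have cardS1 : #|S :\ u| <= m by have := card_tail leS1; rewrite /=; lia.
rewrite [tail_size i C](tail_sizeS u) (cardsD1 u S).
have [uS|uS] := boolP (u \in S); last first.
  have -> : S = S :\ u.
    by apply/setP => x; rewrite !inE; case: eqP uS => // -> /negPf.
  (* Both powers now carry a factor 2, so the bound survives halving [C u] with rounding down. *)
  rewrite add0n setDDl setUid subSn // !expnS => hyp.
  apply: (coverable_push leS1) => D leD; apply: IH leS1 _ => /=; first by lia.
  by move: hyp leD => /=; lia.
rewrite add1n subSS -{2}(setD1K uS).
have [Cu0|Cu0] := posnP (C u); last first.
  have leu := @stack_le _ C u 1 Cu0.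
  move=> hyp; rewrite -(config_subK leu); apply: coverable_add.
    exists (stack (G := path_graph n) u 1); first exact: reach_refl.
    by move=> x /set1P->; rewrite ffunE eqxx.
  apply: (coverable_push leS1) => D; rewrite tail_size_sub // tail_size_stack.
  rewrite ltnn subn0 !ffunE eqxx => leD; apply: IH leS1 _ => /=; first by lia.
  (* Positivity of this power makes up for the pebble kept on [u] and for the rounding. *)
  have : 0 < 2 ^ (m - #|S :\ u|) by rewrite expn_gt0.
  by move: hyp leD; rewrite expnS /=; lia.
rewrite Cu0 add0n expnS => hyp.
have le2 : 2 ^ (m - #|S :\ u|) <= 2 ^ m by rewrite leq_exp2l // leq_subr.
have le_tail : 2 ^ m <= tail_size u C.
  by rewrite tail_sizeS Cu0; move: hyp le2 => /=; lia.
(* [E] has exactly [2 ^ m] pebbles in the tail, the price of one pebble on [u]. None lies on [u]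
   since [C u] is 0, so the supply beyond [u] drops by exactly [2 ^ m]. *)
have [E leE sumE] :=
  @exists_subconfig _ (fun x : path_graph n => i <= val x) C _ le_tail.
rewrite -(config_subK leE); apply: coverable_add.
  have [|D ED Du] := @gather m u 1 E im; first by rewrite mul1n -sumE.
  by exists D => // x /set1P->.
apply: IH leS1 _ => /=; first by lia.
rewrite tail_size_sub //.
have := tail_sizeS u E; rewrite {1}/tail_size sumE.
by have := leE u; move: hyp => /=; lia.
Qed.

Lemma config_size_tail C : config_size C = tail_size 0 C.
Proof. by apply: eq_bigl. Qed.

Lemma all_solvable_path t : t <= n ->
  all_solvable (path_graph n) t (2 ^ n - 2 ^ (n - t)).
Proof.
move=> le_tn C sizeC S cardS; apply: (@coverable_tail n 0) => //.
by rewrite -config_size_tail sizeC cardS subnK // leq_exp2l // leq_subr.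
Qed.

(** * Lower bound by weights, and the exact pebbling numbers *)

(** The factor [2 ^ x] is the number of pebbles on vertex 0 needed to bring one pebble to [x]. *)
Definition weight C : nat := \sum_(x : 'I_n) C x * 2 ^ x.

Lemma weight_add C D : weight (config_add C D) = weight C + weight D.
Proof. by rewrite -big_split; apply: eq_bigr => x _; rewrite ffunE mulnDl. Qed.

Lemma weight_stack (u : 'I_n) k :
  weight (stack (G := path_graph n) u k) = k * 2 ^ u.
Proof.
rewrite /weight (bigD1 u) //= ffunE eqxx big1 ?addn0 // => x /negPf xu.
by rewrite ffunE xu.
Qed.

Lemma reachable_weight C D : reachable C D -> weight D <= weight C.
Proof.
elim=> // D1 D2 _ le_D1 [u [v [uv le2 ->]]]; apply: leq_trans le_D1.
have le_st := @stack_le _ D1 u 2 le2.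
set E := finfun _.
have -> : E = config_add (stack v 1) (config_sub D1 (stack u 2)).
  by apply/ffunP => x; rewrite !ffunE addnC.
rewrite -{2}(config_subK le_st) !weight_add leq_add2r !weight_stack mul1n.
(* Adjacency gives [v <= u.+1], so the gain [2 ^ v] is at most the loss [2 * 2 ^ u]. *)
by rewrite -expnS leq_exp2l //; move: uv; rewrite /= /path_adj; lia.
Qed.

Lemma sum_pow2_tail t : t <= n ->
  \sum_(x : 'I_n | n - t <= x) 2 ^ x = 2 ^ n - 2 ^ (n - t).
Proof.
elim: t => [_|t IH lt_tn].
  rewrite subn0 subnn big_pred0 // => x.
  by apply/negbTE; rewrite -ltnNge.
have lt_u : n - t.+1 < n by lia.
pose u := Ordinal lt_u.
rewrite (bigD1 u) //= (eq_bigl (fun x : 'I_n => n - t <= x)); last first.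
  by move=> x; rewrite -val_eqE /=; lia.
rewrite IH ?(ltnW lt_tn) // -(subnSK lt_tn).
have : 2 ^ (n - t.+1).+1 <= 2 ^ n by rewrite leq_exp2l //; lia.
by rewrite expnS; lia.
Qed.

Lemma all_solvable_path_ge t k : 0 < t <= n ->
  all_solvable (path_graph n) t k -> 2 ^ n - 2 ^ (n - t) <= k.
Proof.
move=> /andP[t0 le_tn] solv; have n0 : 0 < n by lia.
pose o : 'I_n := Ordinal n0.
pose S : {set path_graph n} := [set x : 'I_n | n - t <= x].
have cardS : #|S| = t.
  have -> : S = ~: [set x : 'I_n | x < n - t].
    by apply/setP => x; rewrite !inE -leqNgt.
  rewrite cardsCs setCK card_ord; set T := [set _ | _].
  have -> : T = [set widen_ord (leq_subr t n) y | y : 'I_(n - t)].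
    apply/setP => x; rewrite inE; apply/idP/imsetP => [ltx|[y _ ->]] /=.
      by exists (Ordinal ltx) => //; exact: val_inj.
    exact: ltn_ord.
  rewrite card_imset ?card_ord ?subKn // => y z /(congr1 val) /= yz.
  exact: val_inj.
have size_k : config_size (stack (G := path_graph n) o k) = k.
  by rewrite config_size_tail tail_size_stack mul1n.
(* The initial weight is [k], and a configuration covering [S] weighs at least the sum of [2 ^ x]
   over [S]. *)
have [D /reachable_weight + SD] := solv _ size_k S cardS.
rewrite weight_stack muln1; apply: leq_trans.
rewrite -sum_pow2_tail // /weight.
rewrite [leqRHS](bigID (fun x : 'I_n => n - t <= x)) /=.
apply: leq_trans (leq_addr _ _); apply: leq_sum => x lex.
by rewrite leq_pmull // SD // inE.
Qed.

Lemma pebbling_number_path t : 0 < t <= n ->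
  pebbling_number (path_graph n) t = 2 ^ n - 2 ^ (n - t).
Proof.
move=> tn; have /andP[_ le_tn] := tn.
have [solv least] := pebbling_numberP (all_solvable_path le_tn).
apply/eqP; rewrite eqn_leq least ?all_solvable_path_ge //.
exact: all_solvable_path.
Qed.

End Path.

(** * The ratio as a rational number *)

Import GRing.Theory Num.Theory.
Local Open Scope ring_scope.

(** In this factored form [n] occurs only in a power of 2, which cancels in the ratio up to a factor
    2. *)
Lemma pebbling_number_pathR (n t : nat) : (0 < t <= n)%N ->
  (pebbling_number (path_graph n) t)%:R = 2 ^+ (n - t) * (2 ^+ t - 1) :> rat.
Proof.
move=> tn; have /andP[_ le_tn] := tn.
rewrite pebbling_number_path // natrB ?leq_exp2l ?leq_subr // !natrX.
by rewrite mulrBr mulr1 -exprD subnK.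
Qed.

Lemma pebbling_ratio_path (t n : nat) : (1 <= t)%N -> (t.+1 <= n)%N ->
  pebbling_ratio (path_graph n) t
    = (2 ^+ t.+1 - 1) / (2 * (2 ^+ t - 1)) :> rat.
Proof.
move=> t0 tn; rewrite /pebbling_ratio !pebbling_number_pathR ?t0 ?(ltnW tn) //.
rewrite -(subnSK tn) [2 ^+ (n - t.+1).+1]exprSr -mulrA -mulf_div.
by rewrite divff ?mul1r // expf_neq0.
Qed.

Theorem theorem17 (t : nat) (ht : (1 <= t)%N) :
  (forall m n : nat, (t.+1 <= m)%N -> (t.+1 <= n)%N ->
     pebbling_ratio (path_graph m) t = pebbling_ratio (path_graph n) t) /\
  (forall n : nat, (t.+1 <= n)%N ->
     pebbling_ratio (path_graph n) t
       = (2 ^+ t.+1 - 1) / (2 * (2 ^+ t - 1)) :> rat).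
Proof.
split=> [m n tm tn|n tn]; last exact: pebbling_ratio_path.
by rewrite !pebbling_ratio_path.
Qed.
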